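(* Let $r\in(0,1]$ and assume every valuation $v_i$ is homogeneous of degree $r$, concave, and differentiable. Fix $\rho\in(0,1]$. Then for any allocation $\mathbf{x}$, we have $\mathbf{x}\in\Psi(\rho)$ if and only if there exist $q_1,\dots,q_m\in\mathbb{R}_{\ge 0}$ such that, for the pricing rule \[ p(y)=\rho\, r^{\frac{\rho-1}{\rho}}\Big(\sum_{j\in M}q_j y_j\Big)^{1/\rho}\qquad (y\in\mathbb{R}^m_{\ge0}), \] $(\mathbf{x},p)$ is a Walrasian equilibrium. Furthermore, such $q_1,\dots,q_m$ are optimal Lagrange multipliers for Program $(P_\rho)$.
   Context: Setup: agents $N=\{1,\dots,n\}$, divisible goods $M=\{1,\dots,m\}$, each of supply $1$. An allocation is $\mathbf{x}=(x_1,\dots,x_n)$ with bundles $x_i\in\mathbb{R}^m_{\ge0}$ ($x_{ij}$ = amount of good $j$ given to agent $i$) satisfying $\sum_i x_{ij}\le 1$ for all $j$. Each agent $i$ has a valuation $v_i:\mathbb{R}^m_{\ge0}\to\mathbb{R}_{\ge0}$ that is monotone (coordinatewise larger bundles have weakly larger value), normalized ($v_i(0)=0$), and not identically zero. $v_i$ is homogeneous of degree $r$ if $v_i(\lambda y)=\lambda^r v_i(y)$ for all $\lambda\ge0$ and bundles $y$. Agents have quasilinear utility: under a pricing rule $p:\mathbb{R}^m_{\ge0}\to\mathbb{R}$, agent $i$'s demand set is $D_i(p)=\arg\max_{y\in\mathbb{R}^m_{\ge0}}(v_i(y)-p(y))$. Good $j$ has nonzero cost under $p$ if there is a bundle $y$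 with $y_\ell=0$ for all $\ell\ne j$ and $p(y)>0$. $(\mathbf{x},p)$ is a Walrasian equilibrium (WE) if $x_i\in D_i(p)$ for every $i$, $\sum_i x_{ij}\le 1$ for every $j$, and $\sum_i x_{ij}=1$ for every good $j$ of nonzero cost. For $\rho\in(0,1]$, $\Psi(\rho)$ is the set of allocations maximizing the CES welfare $\Phi(\rho,\mathbf{x})=(\sum_{i}v_i(x_i)^\rho)^{1/\rho}$ over all allocations. Program $(P_\rho)$: maximize $\frac1\rho\sum_i v_i(x_i)^\rho$ over $\mathbf{x}\in\mathbb{R}^{n\times m}_{\ge0}$ subject to $\sum_i x_{ij}\le1$ for all $j$. For differentiable $v_i$, $q\in\mathbb{R}^m_{\ge0}$ is a vector of optimal Lagrange multipliers for $(P_\rho)$ if there is an optimal $\mathbf{x}$ such that (i) for all $i,j$: $v_i(x_i)^{\rho-1}\frac{\partial v_i(x_i)}{\partial x_{ij}}\le q_j$, with equality whenever $x_{ij}>0$; and (ii) $q_j=0$ whenever $\sum_i x_{ij}<1$. *)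

(* Defs.v *)
From HB Require Import structures.
From mathcomp Require Import all_boot all_order all_algebra.
From mathcomp Require Import all_classical all_reals all_analysis.
Set Implicit Arguments. Unset Strict Implicit. Unset Printing Implicit Defensive.
Import Order.TTheory GRing.Theory Num.Theory.
Import numFieldNormedType.Exports.
Local Open Scope classical_set_scope.
Local Open Scope ring_scope.

Section Market.
Variable R : realType.

Definition bundle_nonneg (m : nat) (y : 'rV[R]_m) : Prop :=
  forall j : 'I_m, 0 <= y 0 j.

Definition unitv (m : nat) (j : 'I_m) : 'rV[R]_m := delta_mx 0 j.

(* An allocation: an n x m matrix, row i = bundle x_i of agent i. *)
Definition is_allocation (n m : nat) (x : 'M[R]_(n, m)) : Prop :=
  (forall i j, 0 <= x i j) /\ (forall j, \sum_(i < n) x i j <= 1).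

(* Standing assumptions on a valuation (defined on R^m_{>=0}; values of v
   outside the orthant are irrelevant except for differentiability). *)
Definition valuation (m : nat) (v : 'rV[R]_m -> R) : Prop :=
  [/\ (forall y : 'rV[R]_m, bundle_nonneg y -> 0 <= v y),
      (forall y z : 'rV[R]_m, bundle_nonneg y -> (forall j, y 0 j <= z 0 j) -> v y <= v z),
      v 0 = 0 &
      (exists y : 'rV[R]_m, bundle_nonneg y /\ v y != 0)].

Definition homogeneous (m : nat) (r : R) (v : 'rV[R]_m -> R) : Prop :=
  forall (lam : R) (y : 'rV[R]_m), 0 <= lam -> bundle_nonneg y ->
    v (lam *: y) = lam `^ r * v y.

Definition concave_on_orthant (m : nat) (v : 'rV[R]_m -> R) : Prop :=
  forall (y z : 'rV[R]_m) (t : R), bundle_nonneg y -> bundle_nonneg z ->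
    0 <= t -> t <= 1 ->
    (1 - t) * v y + t * v z <= v ((1 - t) *: y + t *: z).

Definition differentiable_on_orthant (m : nat) (v : 'rV[R]_m -> R) : Prop :=
  forall y : 'rV[R]_m, bundle_nonneg y -> y != 0 -> differentiable v y.

(* partial derivative dv(y)/dy_j, taken as the (right) derivative along e_j;
   it coincides with the usual partial derivative wherever v is differentiable. *)
Definition partial (m : nat) (v : 'rV[R]_m -> R) (y : 'rV[R]_m) (j : 'I_m) : R :=
  lim ((fun t : R => (v (y + t *: unitv j) - v y) / t) @ 0^'+).

Definition in_demand (m : nat) (v p : 'rV[R]_m -> R) (y : 'rV[R]_m) : Prop :=
  bundle_nonneg y /\
  forall z, bundle_nonneg z -> v z - p z <= v y - p y.

Definition nonzero_cost (m : nat) (p : 'rV[R]_m -> R) (j : 'I_m) : Prop :=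
  exists y : 'rV[R]_m, bundle_nonneg y /\
    (forall l : 'I_m, l != j -> y 0 l = 0) /\ 0 < p y.

Definition walrasian_eq (n m : nat) (v : 'I_n -> 'rV[R]_m -> R)
    (x : 'M[R]_(n, m)) (p : 'rV[R]_m -> R) : Prop :=
  [/\ (forall i, in_demand (v i) p (row i x)),
      (forall j, \sum_(i < n) x i j <= 1) &
      (forall j, nonzero_cost p j -> \sum_(i < n) x i j = 1)].

Definition ces_welfare (n m : nat) (v : 'I_n -> 'rV[R]_m -> R) (rho : R)
    (x : 'M[R]_(n, m)) : R :=
  (\sum_(i < n) (v i (row i x)) `^ rho) `^ rho^-1.

Definition in_Psi (n m : nat) (v : 'I_n -> 'rV[R]_m -> R) (rho : R)
    (x : 'M[R]_(n, m)) : Prop :=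
  is_allocation x /\
  forall x', is_allocation x' -> ces_welfare v rho x' <= ces_welfare v rho x.

Definition P_objective (n m : nat) (v : 'I_n -> 'rV[R]_m -> R) (rho : R)
    (x : 'M[R]_(n, m)) : R :=
  rho^-1 * \sum_(i < n) (v i (row i x)) `^ rho.

Definition P_optimal (n m : nat) (v : 'I_n -> 'rV[R]_m -> R) (rho : R)
    (x : 'M[R]_(n, m)) : Prop :=
  (forall i j, 0 <= x i j) /\ (forall j, \sum_(i < n) x i j <= 1) /\
  forall x' : 'M[R]_(n, m), (forall i j, 0 <= x' i j) ->
    (forall j, \sum_(i < n) x' i j <= 1) ->
    P_objective v rho x' <= P_objective v rho x.

Definition optimal_lagrange (n m : nat) (v : 'I_n -> 'rV[R]_m -> R) (rho : R)
    (q : 'I_m -> R) : Prop :=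
  (forall j, 0 <= q j) /\
  exists x : 'M[R]_(n, m), P_optimal v rho x /\
    (forall i j,
       (v i (row i x)) `^ (rho - 1) * partial (v i) (row i x) j <= q j /\
       (0 < x i j -> (v i (row i x)) `^ (rho - 1) * partial (v i) (row i x) j = q j)) /\
    (forall j, \sum_(i < n) x i j < 1 -> q j = 0).

Definition ces_price (m : nat) (rho r : R) (q : 'I_m -> R) (y : 'rV[R]_m) : R :=
  rho * r `^ ((rho - 1) / rho) * (\sum_(j < m) q j * y 0 j) `^ rho^-1.

End Market.

(* Main.v *)
Require Import Defs.
From mathcomp Require Import all_boot all_order all_algebra.
From mathcomp Require Import all_classical all_reals all_analysis.
From mathcomp Require Import lra ring.
Set Implicit Arguments. Unset Strict Implicit. Unset Printing Implicit Defensive.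
Import Order.TTheory GRing.Theory Num.Theory.
Import numFieldNormedType.Exports.
Local Open Scope classical_set_scope.
Local Open Scope ring_scope.

(* Both equilibrium and optimality of [x] are equivalent to the existence of a
   price vector [q], zero on unsold goods, such that for every agent
     v x_i ^ (rho - 1) * (v z - v x_i) <= q . z - q . x_i   for all bundles z.
   Scaling [z = (1 + t) x_i] in this inequality gives Euler's identity
   [q . x_i = r * v x_i ^ rho]; at that cost the derivative of the CES price is
   [v x_i ^ (1 - rho)], so the inequality is the first-order condition for the
   demand of [i], sufficient because the price is convex.  Multiplied by [rho]
   and summed over agents it is also the first-order condition for
   [\sum_i v x_i ^ rho].  For an optimal [x], such a [q] is obtained by
   perturbing the allocation. *)

(** * Tangent-line inequalities for real powers *)

Lemma powR_bernoulli (R : realType) (u b : R) : 0 <= u -> 0 < b -> b <= 1 ->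
  u `^ b <= 1 + b * (u - 1).
Proof.
move=> u0 b0; rewrite le_eqVlt => /predU1P[->|b1].
  by rewrite powRr1// mul1r addrC subrK.
have c0 : 0 < 1 - b by rewrite subr_gt0.
(* Young's inequality for [u ^ b] and [1] with conjugate exponents [1 / b] and [1 / (1 - b)]; the
   latter makes sense only for [b < 1], hence the separate case [b = 1]. *)
have := @conjugate_powR R (u `^ b) 1 b^-1 (1 - b)^-1 (powR_ge0 _ _) ler01.
rewrite !invr_gt0 !invrK => /(_ b0 c0 (subrKC _ _)).
rewrite -powRrM mulfV ?gt_eqF// powRr1// powR1 mulr1 mul1r; lra.
Qed.

(** Bernoulli at [T / S], rescaled by [S ^ b]. The value [S = 0] is admissible at [b = 1] because
    [0 ^ 0 = 1]. *)
Lemma powR_tangent_le (R : realType) (S T b : R) :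
  0 <= S -> 0 <= T -> 0 < b -> b <= 1 -> 0 < S \/ b = 1 ->
  T `^ b <= S `^ b + b * S `^ (b - 1) * (T - S).
Proof.
move=> S0 T0 b0 b1 [Sp|->]; last first.
  by rewrite subrr powRr0 !powRr1// !mul1r addrC subrK.
have := powR_bernoulli (divr_ge0 T0 S0) b0 b1.
rewrite -(ler_pM2l (powR_gt0 b Sp)) -powRM ?divr_ge0//.
rewrite (mulrC S) divfK ?gt_eqF// => /le_trans; apply.
rewrite -{1}(mulr_powRB1 S0 b0) -(mulr_powRB1 S0 b0).
by rewrite le_eqVlt; apply/orP; left; apply/eqP; field; rewrite gt_eqF.
Qed.

(** Bernoulli with exponent [1 / a] at [(T / S) ^ a]: inverting the power turns the concave bound
    into the convex one. *)
Lemma powR_tangent_ge (R : realType) (S T a : R) :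
  0 <= S -> 0 <= T -> 1 <= a -> 0 < S \/ a = 1 ->
  S `^ a + a * S `^ (a - 1) * (T - S) <= T `^ a.
Proof.
move=> S0 T0 a1 [Sp|->]; last first.
  by rewrite subrr powRr0 !powRr1// !mul1r addrC subrK.
have a0 : 0 < a := lt_le_trans ltr01 a1.
have := @powR_bernoulli R ((T / S) `^ a) a^-1 (powR_ge0 _ _).
rewrite invr_gt0 invf_le1// => /(_ a0 a1).
rewrite -powRrM mulfV ?gt_eqF// powRr1 ?divr_ge0// => h.
have -> : T `^ a = S `^ a * (T / S) `^ a.
  by rewrite -powRM ?divr_ge0// (mulrC S) divfK// gt_eqF.
have : 1 + a * (T / S - 1) <= (T / S) `^ a.
  have := ler_wpM2l (ltW a0) h.
  rewrite mulrDr (mulrA a a^-1) mulfV ?gt_eqF// mul1r mulr1; lra.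
rewrite -(ler_pM2l (powR_gt0 a Sp)); apply: le_trans.
rewrite -(mulr_powRB1 S0 a0) le_eqVlt; apply/orP; left; apply/eqP.
by field; rewrite gt_eqF.
Qed.

(** * One-sided difference quotients *)

Lemma dir_quotient_cvg (R : realType) (V : normedModType R) (f : V -> R) (a v : V) :
  differentiable f a ->
  ((f (a + t *: v) - f a) / t) @[t --> 0^'+] --> 'd f a v.
Proof.
move=> df; rewrite -deriveE//.
have dv : derivable f a v by exact: diff_derivable.
have /cvg_dnbhs_at_right := (dv : _ --> _).
rewrite /derive.
by under eq_fun do rewrite /= [_ *: _ + a]addrC [_ *: (_ - _)]mulrC.
Qed.

Lemma powR_quotient_cvg (R : realType) (W D b : R) :
  0 <= W -> 0 < W \/ b = 1 -> (forall t, 0 < t -> t <= 1 -> 0 <= W + t * D) ->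
  (((W + t * D) `^ b - W `^ b) / t) @[t --> 0^'+] --> b * W `^ (b - 1) * D.
Proof.
move=> W0 [Wp _|-> hD]; last first.
  rewrite subrr powRr0 !mul1r.
  apply: (@cvg_trans _ ((fun=> D) @ 0^'+)); last exact: cvg_cst.
  apply: near_eq_cvg; near=> t.
  have t0 : 0 < t by near: t; exact: nbhs_right_gt.
  have t1 : t <= 1 by near: t; apply: nbhs_right_le.
  rewrite !powRr1 ?hD//.
  by rewrite addrAC subrr add0r mulrAC mulfV ?mul1r// gt_eqF.
have [dP dE] := is_derive1_powR b Wp.
have df : differentiable (@powR R ^~ b) W by apply/derivable1_diffP.
have dD : 'd (@powR R ^~ b) W D = b * W `^ (b - 1) * D.
  have -> : D = D *: (1 : R^o) by rewrite [RHS]mulr1.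
  by rewrite linearZ/= -deriveE// dE [LHS]mulrC [D *: _]mulr1.
rewrite -dD; exact: (@dir_quotient_cvg R R^o _ _ D df).
Unshelve. all: by end_near. Qed.

Lemma nbhs_right_affine_ge0 (R : realType) (a b : R) :
  0 < a \/ a = 0 /\ 0 <= b -> \forall t \near 0^'+, 0 <= a + t * b.
Proof.
case=> [a0|[-> b0]]; near=> t; last first.
  rewrite add0r mulr_ge0//; apply/ltW; near: t; exact: nbhs_right_gt.
have t0 : 0 < t by near: t; exact: nbhs_right_gt.
have tb : t <= a / (1 + `|b|).
  by near: t; apply: nbhs_right_le; rewrite divr_gt0// ltr_wpDr.
have b1 : 0 < 1 + `|b| by rewrite ltr_wpDr.
move: tb; rewrite ler_pdivlMr// mulrDr mulr1 => tb.
have : - (t * `|b|) <= t * b by rewrite -mulrN ler_pM2l// lerNnormlW.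
lra.
Unshelve. all: by end_near. Qed.

Lemma cvg_sum_le (R : realType) (I : finType) (f : I -> R -> R) (l : I -> R) (C : R) :
  (forall i, f i t @[t --> 0^'+] --> l i) ->
  (\forall t \near 0^'+, \sum_i f i t <= C) -> \sum_i l i <= C.
Proof.
move=> fl fC.
have h : (\sum_i f i t) @[t --> 0^'+] --> \sum_i l i.
  by apply: cvg_big => [|i _]; [exact: add_continuous|exact: fl].
by apply: (cvgr_to_le h).
Qed.

(** Dividing by [t] and letting it tend to zero turns a bound on increments into one on derivatives.
    The arbitrary finite index type covers a single agent, a value against a price, and all agents
    at once. *)
Lemma powR_slope_le (R : realType) (I : finType) (K W D b : I -> R) (C : R) :
  (forall i, 0 <= W i) -> (forall i, 0 < W i \/ b i = 1) ->
  (forall i t, 0 < t -> t <= 1 -> 0 <= W i + t * D i) ->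
  (forall t, 0 < t -> t <= 1 ->
     \sum_i K i * ((W i + t * D i) `^ b i - W i `^ b i) <= t * C) ->
  \sum_i K i * (b i * W i `^ (b i - 1) * D i) <= C.
Proof.
move=> W0 Wb WD h.
apply: (@cvg_sum_le R I (fun i t => K i * (((W i + t * D i) `^ b i - W i `^ b i) / t))).
  by move=> i; apply: cvgMl_tmp; apply: powR_quotient_cvg => // t; exact: WD.
near=> t.
have t0 : 0 < t by near: t; exact: nbhs_right_gt.
have t1 : t <= 1 by near: t; apply: nbhs_right_le.
under eq_bigr do rewrite mulrA.
by rewrite -mulr_suml ler_pdivrMr// mulrC h.
Unshelve. all: by end_near. Qed.

(** * Supporting prices and Euler's identity *)

Definition cost (R : realType) (m : nat) (q : 'I_m -> R) (y : 'rV[R]_m) : R :=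
  \sum_j q j * y 0 j.

(** On the orthant, [q] is a supergradient at [x] of [v] rescaled by [v x ^ (rho - 1)], the marginal
    weight of [v] in [v ^ rho / rho]. *)
Definition supporting (R : realType) (m : nat) (v : 'rV[R]_m -> R) (rho : R)
    (q : 'I_m -> R) (x : 'rV[R]_m) : Prop :=
  forall z, bundle_nonneg z ->
    v x `^ (rho - 1) * (v z - v x) <= cost q z - cost q x.

(* An agent may have value zero only when r = rho = 1: otherwise the marginal
   value of [v ^ rho] at zero is infinite. *)
Definition regular (R : realType) (r rho W : R) : Prop :=
  0 < W \/ r = 1 /\ rho = 1.

Lemma costD (R : realType) (m : nat) (q : 'I_m -> R) (y z : 'rV[R]_m) :
  cost q (y + z) = cost q y + cost q z.
Proof. by rewrite -big_split; apply: eq_bigr => j _; rewrite mxE mulrDr. Qed.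

Lemma costZ (R : realType) (m : nat) (q : 'I_m -> R) (a : R) (y : 'rV[R]_m) :
  cost q (a *: y) = a * cost q y.
Proof. by rewrite mulr_sumr; apply: eq_bigr => j _; rewrite mxE mulrCA. Qed.

Lemma cost_ge0 (R : realType) (m : nat) (q : 'I_m -> R) (y : 'rV[R]_m) :
  (forall j, 0 <= q j) -> bundle_nonneg y -> 0 <= cost q y.
Proof. by move=> q0 y0; apply: sumr_ge0 => j _; exact: mulr_ge0. Qed.

Lemma bundle_nonnegD (R : realType) (m : nat) (y z : 'rV[R]_m) :
  bundle_nonneg y -> bundle_nonneg z -> bundle_nonneg (y + z).
Proof. by move=> y0 z0 j; rewrite mxE addr_ge0. Qed.

Lemma bundle_nonnegZ (R : realType) (m : nat) (a : R) (y : 'rV[R]_m) :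
  0 <= a -> bundle_nonneg y -> bundle_nonneg (a *: y).
Proof. by move=> a0 y0 j; rewrite mxE mulr_ge0. Qed.

Lemma bundle_nonneg0 (R : realType) (m : nat) : bundle_nonneg (0 : 'rV[R]_m).
Proof. by move=> j; rewrite mxE. Qed.

Lemma supporting_cost (R : realType) (m : nat) (v : 'rV[R]_m -> R) (r rho : R)
    (q : 'I_m -> R) (x : 'rV[R]_m) :
  0 < r -> 0 < rho -> homogeneous r v -> bundle_nonneg x -> 0 <= v x ->
  supporting v rho q x -> cost q x = r * v x `^ rho.
Proof.
move=> r0 rho0 vr x0 W0 S.
(* The comparison is with [(1 + t * s) x], a bundle for [0 < t <= 1] as soon as [s >= -1]. The bound
   is linear in [s], so [s = 1] and [s = -1] together give equality. *)
have key (s : R) : -1 <= s -> v x `^ rho * (r * s) <= s * cost q x.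
  move=> s1.
  have pos t : 0 < t -> t <= 1 -> 0 <= 1 + t * s.
    move=> t0 t1; have : t * -1 <= t * s by rewrite ler_pM2l.
    lra.
  have := @powR_slope_le R 'I_1 (fun=> v x `^ rho) (fun=> 1) (fun=> s) (fun=> r)
    (s * cost q x).
  rewrite big_ord1 powR1 mulr1; apply=> //; first by left.
  move=> t t0 t1; rewrite big_ord1.
  have := S _ (bundle_nonnegZ (pos _ t0 t1) x0).
  rewrite costZ vr ?pos// -[in v x `^ rho](mulr_powRB1 W0 rho0) => h.
  rewrite (_ : _ * (_ - 1) = v x `^ (rho - 1) * ((1 + t * s) `^ r * v x - v x)); last by ring.
  by apply: le_trans h _; rewrite le_eqVlt; apply/orP; left; apply/eqP; ring.
have h1 := key 1 ltac:(lra); have h2 := key (-1) (lexx _).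
lra.
Qed.

(** * Demand under the CES price *)

Lemma ces_priceZ (R : realType) (m : nat) (rho r : R) (q : 'I_m -> R) (a : R)
    (y : 'rV[R]_m) :
  (forall j, 0 <= q j) -> 0 <= a -> bundle_nonneg y ->
  ces_price rho r q (a *: y) = a `^ rho^-1 * ces_price rho r q y.
Proof.
move=> q0 a0 y0; rewrite /ces_price -!/(cost _ _) costZ powRM//; last exact: cost_ge0.
by ring.
Qed.

(** Along the ray through [x] the value has degree [r] and the price degree [1 / rho]; utility is
    stationary at the demanded scale. *)
Lemma demand_foc (R : realType) (m : nat) (v : 'rV[R]_m -> R) (r rho : R)
    (q : 'I_m -> R) (x : 'rV[R]_m) :
  0 < r -> 0 < rho -> homogeneous r v -> (forall j, 0 <= q j) ->
  in_demand v (ces_price rho r q) x -> rho * r * v x = ces_price rho r q x.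
Proof.
move=> r0 rho0 vr q0 [x0 dx].
have key (s : R) : -1 <= s -> v x * (r * s) - ces_price rho r q x * (rho^-1 * s) <= 0.
  move=> s1.
  have pos t : 0 < t -> t <= 1 -> 0 <= 1 + t * s.
    move=> t0 t1; have : t * -1 <= t * s by rewrite ler_pM2l.
    lra.
  have := @powR_slope_le R bool (fun b => if b then v x else - ces_price rho r q x)
    (fun=> 1) (fun=> s) (fun b => if b then r else rho^-1) 0.
  rewrite big_bool/= !powR1 !mulr1 mulNr; apply=> //; first by left.
  move=> t t0 t1; rewrite big_bool /= ?powR1.
  have := dx _ (bundle_nonnegZ (pos _ t0 t1) x0).
  rewrite ces_priceZ ?pos// vr ?pos//; lra.
have h1 := key 1 ltac:(lra); have h2 := key (-1) (lexx _).
have : r * v x = rho^-1 * ces_price rho r q x by lra.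
by move=> h; rewrite -mulrA h mulVKf// gt_eqF.
Qed.

Lemma powR_small (R : realType) (e V P : R) : 0 < e -> 0 < V -> 0 <= P ->
  exists2 l, 0 < l <= 1 & l `^ e * P < V.
Proof.
move=> e0 V0 P0; have PV : 0 < P + V by rewrite ltr_wpDl.
have f0 : 0 < V / (P + V) by rewrite divr_gt0.
(* Dividing by [P + V] rather than [P] keeps the base in [(0, 1]] and allows [P = 0]. *)
exists ((V / (P + V)) `^ e^-1).
  have f1 : V / (P + V) <= 1 by rewrite ler_pdivrMr// mul1r; lra.
  have : (V / (P + V)) `^ e^-1 <= 1 `^ e^-1.
    by rewrite ge0_ler_powR ?nnegrE ?invr_ge0// ltW.
  by rewrite powR1 powR_gt0.
rewrite -powRrM mulVf ?gt_eqF// powRr1 ?ltW// mulrAC ltr_pdivrMr//.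
by rewrite ltr_pM2l//; lra.
Qed.

Lemma ces_price_ge0 (R : realType) (m : nat) (rho r : R) (q : 'I_m -> R)
  (y : 'rV[R]_m) : 0 <= rho -> 0 <= ces_price rho r q y.
Proof. by move=> rho0; rewrite !mulr_ge0 ?powR_ge0. Qed.

(** If [r < 1 / rho], a demanded bundle of value zero has price zero by [demand_foc], while a small
    multiple of a valued bundle earns positive utility, its price vanishing faster than its
    value. *)
Lemma demand_regular (R : realType) (m : nat) (v : 'rV[R]_m -> R) (r rho : R)
    (q : 'I_m -> R) (x : 'rV[R]_m) :
  0 < r -> r <= 1 -> 0 < rho -> rho <= 1 -> valuation v -> homogeneous r v ->
  (forall j, 0 <= q j) ->
  in_demand v (ces_price rho r q) x -> regular r rho (v x).
Proof.
move=> r0 r1 rho0 rho1 [v0 _ _ [y [y0 vy]]] vr q0 dx.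
have [x0 dx'] := dx.
have [e0|e0] := ltP 0 (rho^-1 - r); last first.
  right.
  have := ltr0n R 1; have : 1 <= rho^-1 by rewrite invf_ge1.
  move=> h _; have -> : r = 1 by lra.
  by split => //; apply: invr_inj; rewrite invr1; lra.
left; rewrite lt_neqAle v0// andbT; apply/eqP => W0.
have vy0 : 0 < v y by rewrite lt_neqAle eq_sym vy v0.
have [l /andP[l0 l1]] := powR_small e0 vy0 (ces_price_ge0 r q y (ltW rho0)).
have := dx' _ (bundle_nonnegZ (ltW l0) y0).
rewrite -(demand_foc r0 rho0 vr q0 dx) -W0 mulr0 subr0.
rewrite vr ?ces_priceZ ?(ltW l0)// => h.
rewrite -(ltr_pM2l (powR_gt0 r l0)) mulrA -powRD; last by apply/implyP => _; rewrite gt_eqF.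
by rewrite subrKC => h'; lra.
Qed.

(** The constant of the CES price is chosen for this normalization: at the Euler cost, the
    derivative of the price in the cost is inverse to the weight in [supporting]. For [r = rho = 1]
    only zeroth powers remain, equal to [1] even at [W = 0]. *)
Lemma price_slope (R : realType) (r rho W : R) : 0 < r -> 0 < rho ->
  regular r rho W ->
  W `^ (rho - 1) *
    (rho * r `^ ((rho - 1) / rho) * (rho^-1 * (r * W `^ rho) `^ (rho^-1 - 1))) = 1.
Proof.
move=> r0 rho0; have rho_neq0 : rho != 0 by rewrite gt_eqF.
case=> [W0|[-> ->]]; last by rewrite divr1 invr1 subrr !powRr0 !mul1r.
have -> : rho^-1 - 1 = - ((rho - 1) / rho) by field.
rewrite (_ : _ * (_ * _) = (W `^ (rho - 1)) * (r `^ ((rho - 1) / rho) *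
  (r * W `^ rho) `^ (- ((rho - 1) / rho)))); last by field.
rewrite powRM ?powR_ge0 ?(ltW r0)// -powRrM (_ : rho * _ = - (rho - 1)); last by field.
rewrite !powRN.
by field; rewrite !gt_eqF ?powR_gt0.
Qed.

Lemma demand_cost (R : realType) (m : nat) (v : 'rV[R]_m -> R) (r rho : R)
    (q : 'I_m -> R) (x : 'rV[R]_m) :
  0 < r -> 0 < rho -> homogeneous r v -> 0 <= v x -> (forall j, 0 <= q j) ->
  in_demand v (ces_price rho r q) x -> cost q x = r * v x `^ rho.
Proof.
move=> r0 rho0 vr W0 q0 dx; have [x0 _] := dx.
have := demand_foc r0 rho0 vr q0 dx; rewrite /ces_price -/(cost q x) -!mulrA.
have rho_neq0 : rho != 0 by rewrite gt_eqF.
move/(mulfI rho_neq0).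
(* Splitting [r] cancels the constant of the price and leaves [r ^ (1 / rho) * v x = cost q x ^ (1 /
   rho)]. *)
have {1}-> : r = r `^ ((rho - 1) / rho) * r `^ rho^-1.
  rewrite -powRD; last by apply/implyP => _; rewrite gt_eqF.
  rewrite (_ : _ + _ = 1) ?powRr1 ?ltW//; by field.
rewrite -mulrA => /mulfI => /(_ _); rewrite powR_eq0 gt_eqF// => /(_ isT).
move/(congr1 (fun u => u `^ rho)); rewrite -powRrM mulVf// powRr1 ?cost_ge0// => <-.
by rewrite powRM ?powR_ge0// -powRrM mulVf// powRr1// ltW.
Qed.

(** The price is convex, so comparing [x] with [z] alone is too weak; the segment from [x] to [z] is
    used. On it concavity bounds the gain in value below by a chord, and the limit brings in the
    slope of the price at [x]. *)
Lemma demand_supporting (R : realType) (m : nat) (v : 'rV[R]_m -> R) (r rho : R)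
    (q : 'I_m -> R) (x : 'rV[R]_m) :
  0 < r -> r <= 1 -> 0 < rho -> rho <= 1 -> valuation v -> homogeneous r v ->
  concave_on_orthant v -> (forall j, 0 <= q j) ->
  in_demand v (ces_price rho r q) x -> supporting v rho q x.
Proof.
move=> r0 r1 rho0 rho1 vv vr vc q0 dx z z0.
have reg := demand_regular r0 r1 rho0 rho1 vv vr q0 dx.
have [x0 dx'] := dx; have [v0 _ _ _] := vv.
have Qx := demand_cost r0 rho0 vr (v0 _ x0) q0 dx.
have sl := price_slope r0 rho0 reg.
set K := rho * r `^ ((rho - 1) / rho) in sl *.
have seg t : 0 < t -> t <= 1 -> bundle_nonneg ((1 - t) *: x + t *: z).
  by move=> t0 t1; apply: bundle_nonnegD; apply: bundle_nonnegZ => //; lra.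
have cseg t : cost q ((1 - t) *: x + t *: z) = cost q x + t * (cost q z - cost q x).
  by rewrite costD !costZ; ring.
have := @powR_slope_le R 'I_1 (fun=> - K) (fun=> cost q x)
  (fun=> cost q z - cost q x) (fun=> rho^-1) (- (v z - v x)).
rewrite big_ord1 => h.
have {}h : - K * (rho^-1 * cost q x `^ (rho^-1 - 1) * (cost q z - cost q x)) <=
    - (v z - v x).
  apply: h.
  - by move=> _; exact: cost_ge0.
  - move=> _; rewrite Qx; case: reg => [W0|[_ ->]]; last by right; rewrite invr1.
    by left; rewrite mulr_gt0// powR_gt0.
  - by move=> _ t t0 t1; rewrite -cseg; apply: cost_ge0 => //; exact: seg.
  move=> t t0 t1; rewrite big_ord1 -cseg.
  have := dx' _ (seg t t0 t1).
  have := vc x z t x0 z0 (ltW t0) t1.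
  rewrite /ces_price -!/(cost _ _) -/K; lra.
have a0 : 0 < v x `^ (rho - 1).
  by case: reg => [W0|[_ ->]]; [exact: powR_gt0|rewrite subrr powRr0].
have {}h : v z - v x <=
    K * (rho^-1 * cost q x `^ (rho^-1 - 1)) * (cost q z - cost q x) by lra.
by move: h; rewrite -(ler_pM2l a0) mulrA {1}Qx sl mul1r.
Qed.

Lemma supporting_demand (R : realType) (m : nat) (v : 'rV[R]_m -> R) (r rho : R)
    (q : 'I_m -> R) (x : 'rV[R]_m) :
  0 < r -> 0 < rho -> rho <= 1 -> homogeneous r v -> 0 <= v x ->
  (forall j, 0 <= q j) -> bundle_nonneg x -> regular r rho (v x) ->
  supporting v rho q x -> in_demand v (ces_price rho r q) x.
Proof.
move=> r0 rho0 rho1 vr W0 q0 x0 reg S; split=> // z z0.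
have Qx := supporting_cost r0 rho0 vr x0 W0 S.
have sl := price_slope r0 rho0 reg.
have tg : 0 < cost q x \/ rho^-1 = 1.
  rewrite Qx; case: reg => [Wp|[_ ->]]; last by right; rewrite invr1.
  by left; rewrite mulr_gt0// powR_gt0.
have a0 : 0 < v x `^ (rho - 1).
  by case: reg => [Wp|[_ ->]]; [exact: powR_gt0|rewrite subrr powRr0].
have rho1' : 1 <= rho^-1 by rewrite invf_ge1.
have := powR_tangent_ge (cost_ge0 q0 x0) (cost_ge0 q0 z0) rho1' tg.
rewrite /ces_price -!/(cost _ _).
set K := rho * r `^ ((rho - 1) / rho) in sl *.
have K0 : 0 <= K by rewrite mulr_ge0 ?powR_ge0// ltW.
move=> /(ler_wpM2l K0) h.
have : v z - v x <= K * (rho^-1 * cost q x `^ (rho^-1 - 1)) * (cost q z - cost q x).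
  by rewrite -(ler_pM2l a0) mulrA Qx sl mul1r -Qx; exact: S.
lra.
Qed.

(** * Allocations and welfare maximality *)

Definition power_maximal (R : realType) (n m : nat) (v : 'I_n -> 'rV[R]_m -> R)
    (rho : R) (x : 'M[R]_(n, m)) : Prop :=
  forall x', is_allocation x' ->
    \sum_i v i (row i x') `^ rho <= \sum_i v i (row i x) `^ rho.

Lemma in_PsiP (R : realType) (n m : nat) (v : 'I_n -> 'rV[R]_m -> R) (rho : R)
    (x : 'M[R]_(n, m)) :
  0 < rho -> in_Psi v rho x <-> is_allocation x /\ power_maximal v rho x.
Proof.
move=> rho0.
have s0 y : 0 <= \sum_i v i (row i y) `^ rho by apply: sumr_ge0 => i _; exact: powR_ge0.
split=> -[ax h]; (split; first exact: ax) => x' ax'; last first.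
  apply: ge0_ler_powR (h x' ax'); last exact: s0.
    by rewrite invr_ge0 ltW.
  exact: s0.
have powK a : 0 <= a -> a = (a `^ rho^-1) `^ rho.
  by move=> a0; rewrite -powRrM mulVf ?gt_eqF// powRr1.
rewrite (powK _ (s0 x)) (powK _ (s0 x')).
apply: (ge0_ler_powR (ltW rho0) _ _ (h x' ax')); exact: powR_ge0.
Qed.

Lemma row_bundle_nonneg (R : realType) (n m : nat) (x : 'M[R]_(n, m)) i :
  is_allocation x -> bundle_nonneg (row i x).
Proof. by case=> x0 _ j; rewrite mxE. Qed.

Lemma row_convex (R : realType) (n m : nat) (x y : 'M[R]_(n, m)) (t : R) i :
  row i ((1 - t) *: x + t *: y) = (1 - t) *: row i x + t *: row i y.
Proof. by rewrite linearD !linearZ. Qed.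

Lemma allocation_convex (R : realType) (n m : nat) (x y : 'M[R]_(n, m)) (t : R) :
  0 <= t -> t <= 1 -> is_allocation x -> is_allocation y ->
  is_allocation ((1 - t) *: x + t *: y).
Proof.
move=> t0 t1 [x0 x1] [y0 y1].
have t1' : 0 <= 1 - t by lra.
split=> [i j|j]; first by rewrite !mxE addr_ge0// mulr_ge0.
under eq_bigr do rewrite !mxE.
rewrite big_split/= -!mulr_sumr.
have := ler_wpM2l t0 (y1 j); have := ler_wpM2l t1' (x1 j); lra.
Qed.

Lemma sum_cost (R : realType) (n m : nat) (q : 'I_m -> R) (x : 'M[R]_(n, m)) :
  \sum_i cost q (row i x) = \sum_j q j * \sum_i x i j.
Proof.
rewrite exchange_big; apply: eq_bigr => j _; rewrite mulr_sumr.
by apply: eq_bigr => i _; rewrite mxE.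
Qed.

Lemma supporting_maximal (R : realType) (n m : nat) (v : 'I_n -> 'rV[R]_m -> R)
    (r rho : R) (q : 'I_m -> R) (x : 'M[R]_(n, m)) :
  0 < rho -> rho <= 1 -> (forall i, valuation (v i)) ->
  (forall j, 0 <= q j) -> is_allocation x ->
  (forall i, regular r rho (v i (row i x))) ->
  (forall i, supporting (v i) rho q (row i x)) ->
  (forall j, \sum_i x i j < 1 -> q j = 0) -> power_maximal v rho x.
Proof.
move=> rho0 rho1 vv q0 ax reg S slack x' ax'.
(* Goods that [x] leaves unsold are free, so [x] spends the full value of the supply at prices [q],
   and no allocation costs more. *)
have le_cost : \sum_i cost q (row i x') <= \sum_i cost q (row i x).
  rewrite !sum_cost; apply: ler_sum => j _.
  have [x1|x1] := ltP (\sum_i x i j) 1; first by rewrite slack// !mul0r.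
  by apply: ler_wpM2l => //; apply: le_trans x1; exact: ax'.2.
have key i : v i (row i x') `^ rho <=
    v i (row i x) `^ rho + rho * (cost q (row i x') - cost q (row i x)).
  have [v0 _ _ _] := vv i.
  have x'0 := row_bundle_nonneg i ax'.
  have tg : 0 < v i (row i x) \/ rho = 1 by case: (reg i) => [|[]]; [left|right].
  apply: le_trans (powR_tangent_le (v0 _ (row_bundle_nonneg i ax)) (v0 _ x'0) rho0 rho1 tg) _.
  by rewrite lerD2l -mulrA ler_pM2l// S.
apply: le_trans (ler_sum _ (fun i _ => key i)) _.
rewrite big_split/= -mulr_sumr sumrB gerDl pmulr_rle0//; lra.
Qed.

(** Suppose [r * rho < 1] and agent [i] has value zero. Mix [x] with weight [l] on an allocation
    serving [i] alone: the others lose at most order [l], while [i] gains order [l ^ (r * rho)],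
    which dominates for small [l]. *)
Lemma maximal_regular (R : realType) (n m : nat) (v : 'I_n -> 'rV[R]_m -> R)
    (r rho : R) (x : 'M[R]_(n, m)) i :
  0 < r -> r <= 1 -> 0 < rho -> rho <= 1 -> (forall i, valuation (v i)) ->
  (forall i, homogeneous r (v i)) -> (forall i, concave_on_orthant (v i)) ->
  is_allocation x -> power_maximal v rho x -> regular r rho (v i (row i x)).
Proof.
move=> r0 r1 rho0 rho1 vv vr vc ax mx.
have [s1|s1] := ltP (r * rho) 1; last by right; split; nra.
left; have [v0 vm _ [y [y0 vy]]] := vv i.
rewrite lt_neqAle v0 ?andbT; last exact: row_bundle_nonneg.
apply/eqP => W0.
have ysum : 0 <= \sum_j y 0 j by apply: sumr_ge0.
(* This scaling makes every coordinate of [u] at most [1], so [u] fits in the supply. *)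
pose c := (1 + \sum_j y 0 j)^-1; pose u := c *: y.
have c0 : 0 < c by rewrite invr_gt0 ltr_wpDr.
have u0 : bundle_nonneg u by apply: bundle_nonnegZ => //; exact: ltW.
have u1 j : u 0 j <= 1.
  rewrite mxE mulrC ler_pdivrMr ?mul1r ?ltr_wpDr//.
  rewrite (bigD1 j)//=; have : 0 <= \sum_(k | k != j) y 0 k by apply: sumr_ge0.
  lra.
have vu : 0 < v i u.
  by rewrite vr ?(ltW c0)// mulr_gt0 ?powR_gt0// lt_neqAle eq_sym vy v0.
pose e : 'M[R]_(n, m) := \matrix_(k, j) (if k == i then u 0 j else 0).
have ae : is_allocation e.
  split=> [k j|j]; first by rewrite mxE; case: ifP.
  under eq_bigr do rewrite mxE.
  by rewrite -big_mkcond big_pred1_eq.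
have ei : row i e = u by apply/rowP => j; rewrite !mxE eqxx.
pose F := \sum_k v k (row k x) `^ rho.
have F0 : 0 <= F by apply: sumr_ge0 => k _; exact: powR_ge0.
have s1' : 0 < 1 - r * rho by lra.
have [l /andP[l0 l1] hl] := powR_small s1' (powR_gt0 rho vu) F0.
have := mx _ (allocation_convex (ltW l0) l1 ax ae); rewrite leNgt => /negP; apply.
(* For [k != i], concavity keeps a fraction [1 - l] of the value, and [(1 - l) ^ rho >= 1 - l]. For
   [i], the mixed bundle dominates [l *: u], and homogeneity evaluates the latter. *)
have key k : (1 - l) * v k (row k x) `^ rho + (if k == i then l `^ (r * rho) * v i u `^ rho else 0)
    <= v k (row k ((1 - l) *: x + l *: e)) `^ rho.
  have [v0k _ _ _] := vv k.
  have xk0 := row_bundle_nonneg k ax.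
  have zk0 := row_bundle_nonneg k (allocation_convex (ltW l0) l1 ax ae).
  have [->|ki] := eqVneq k i.
    rewrite -W0 powR0 ?gt_eqF// mulr0 add0r powRrM -powRM ?powR_ge0 ?v0// -vr ?(ltW l0)//.
    rewrite ge0_ler_powR ?nnegrE ?(ltW rho0) ?v0//.
    - by apply: bundle_nonnegZ => //; exact: ltW.
    - exact: row_bundle_nonneg (allocation_convex (ltW l0) l1 ax ae).
    apply: vm; first by apply: bundle_nonnegZ => //; exact: ltW.
    move=> j; rewrite row_convex ei !mxE lerDr mulr_ge0//; last exact: ax.1.
    by lra.
  rewrite addr0; have [l1'|l1'] := eqVneq l 1.
    by rewrite l1' subrr mul0r powR_ge0.
  have l1l : 0 < 1 - l by rewrite subr_gt0 lt_neqAle l1' l1.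
  apply: (@le_trans _ _ (((1 - l) * v k (row k x)) `^ rho)).
    rewrite powRM ?v0k// ?(ltW l1l)// ler_wpM2r ?powR_ge0// ger1_powR//.
    by rewrite l1l; lra.
  rewrite ge0_ler_powR ?nnegrE ?(ltW rho0) ?v0k//.
    by rewrite mulr_ge0// ?v0k// ltW.
  have := vc k _ _ l xk0 (row_bundle_nonneg k ae) (ltW l0) l1.
  rewrite -row_convex; apply: le_trans; rewrite lerDl mulr_ge0// ?(ltW l0)// v0k//.
  exact: row_bundle_nonneg.
apply: lt_le_trans (ler_sum _ (fun k _ => key k)).
rewrite big_split/= -mulr_sumr -big_mkcond big_pred1_eq -/F.
have : l `^ (r * rho) * (l `^ (1 - r * rho) * F) < l `^ (r * rho) * v i u `^ rho.
  by rewrite ltr_pM2l// powR_gt0.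
rewrite mulrA -powRD; last by apply/implyP => _; rewrite gt_eqF.
rewrite subrKC powRr1 ?ltW//; lra.
Qed.

(** * First-order conditions at a maximal allocation *)

Lemma maximal_linearized (R : realType) (n m : nat) (v : 'I_n -> 'rV[R]_m -> R)
    (r rho : R) (x x' : 'M[R]_(n, m)) :
  0 < rho -> (forall i, valuation (v i)) -> (forall i, concave_on_orthant (v i)) ->
  is_allocation x -> power_maximal v rho x ->
  (forall i, regular r rho (v i (row i x))) -> is_allocation x' ->
  \sum_i v i (row i x) `^ (rho - 1) * (v i (row i x') - v i (row i x)) <= 0.
Proof.
move=> rho0 vv vc ax mx reg ax'.
have v0 i y : is_allocation y -> 0 <= v i (row i y).
  by move=> ay; have [v0 _ _ _] := vv i; apply: v0; exact: row_bundle_nonneg.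
have WD i t : 0 < t -> t <= 1 ->
    0 <= v i (row i x) + t * (v i (row i x') - v i (row i x)).
  move=> t0 t1; have := v0 i _ ax'; have := v0 i _ ax => h1 h2.
  have : 0 <= 1 - t by lra.
  nra.
have := @powR_slope_le R 'I_n (fun=> 1) (fun i => v i (row i x))
  (fun i => v i (row i x') - v i (row i x)) (fun=> rho) 0.
under eq_bigr do rewrite mul1r -mulrA.
rewrite -mulr_sumr pmulr_rle0//; apply=> //.
- by move=> i; exact: v0.
- by move=> i; case: (reg i) => [|[]]; [left|right].
move=> t t0 t1; rewrite mulr0; under eq_bigr do rewrite mul1r.
rewrite sumrB subr_le0.
(* By concavity the chord values are dominated by the values at the convex combination of [x] and
   [x'], itself an allocation. *)
apply: le_trans (mx _ (allocation_convex (ltW t0) t1 ax ax')).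
apply: ler_sum => i _; rewrite ge0_ler_powR ?nnegrE ?(ltW rho0) ?WD ?v0//.
  exact: allocation_convex (ltW t0) t1 ax ax'.
rewrite row_convex.
have := vc i _ _ t (row_bundle_nonneg i ax) (row_bundle_nonneg i ax') (ltW t0) t1.
by apply: le_trans; lra.
Qed.

Lemma diff_concave (R : realType) (m : nat) (v : 'rV[R]_m -> R) (x z : 'rV[R]_m) :
  concave_on_orthant v -> bundle_nonneg x -> bundle_nonneg z ->
  differentiable v x -> v z - v x <= 'd v x (z - x).
Proof.
move=> vc x0 z0 dv; apply: (cvgr_to_ge (@dir_quotient_cvg _ _ _ _ (z - x) dv)).
near=> t.
have t0 : 0 < t by near: t; exact: nbhs_right_gt.
have t1 : t <= 1 by near: t; apply: nbhs_right_le.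
rewrite ler_pdivlMr//.
have := vc x z t x0 z0 (ltW t0) t1.
have -> : (1 - t) *: x + t *: z = x + t *: (z - x).
  by rewrite scalerBl scale1r scalerBr -addrA [- _ + _]addrC.
lra.
Unshelve. all: by end_near. Qed.

Lemma diff_monotone (R : realType) (m : nat) (v : 'rV[R]_m -> R) (x d : 'rV[R]_m) :
  valuation v -> bundle_nonneg x -> bundle_nonneg d ->
  differentiable v x -> 0 <= 'd v x d.
Proof.
move=> [_ vm _ _] x0 d0 dv; apply: (cvgr_to_ge (@dir_quotient_cvg _ _ _ _ d dv)).
near=> t.
have t0 : 0 < t by near: t; exact: nbhs_right_gt.
apply: divr_ge0; last exact: ltW.
rewrite subr_ge0; apply: vm => // j.
by rewrite !mxE lerDl mulr_ge0// ltW.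
Unshelve. all: by end_near. Qed.

Lemma regular_zero (R : realType) (m : nat) (v : 'rV[R]_m -> R) (r rho : R) :
  valuation v -> regular r rho (v 0) -> r = 1 /\ rho = 1.
Proof. by move=> [_ _ -> _] [|//]; rewrite ltxx. Qed.

(** Differentiability is assumed away from the zero bundle only; at zero, homogeneity of degree one
    makes the quotient constant. *)
Lemma zero_quotient_cvg (R : realType) (m : nat) (v : 'rV[R]_m -> R) (d : 'rV[R]_m) :
  v 0 = 0 -> homogeneous 1 v -> bundle_nonneg d ->
  ((v (0 + t *: d) - v 0) / t) @[t --> 0^'+] --> v d.
Proof.
move=> v00 vr d0; apply: (@cvg_trans _ ((fun=> v d) @ 0^'+)); last exact: cvg_cst.
apply: near_eq_cvg; near=> t.
have t0 : 0 < t by near: t; exact: nbhs_right_gt.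
rewrite add0r vr ?(ltW t0)// powRr1 ?(ltW t0)// v00 subr0 mulrAC mulfV ?mul1r//.
Unshelve. all: by end_near. Qed.

(** With a direction in place of a target allocation, feasibility is required for small [t] only,
    and directional derivatives replace the differences of [maximal_linearized]. *)
Lemma maximal_directional (R : realType) (n m : nat) (v : 'I_n -> 'rV[R]_m -> R)
    (r rho : R) (x d : 'M[R]_(n, m)) (l : 'I_n -> R) :
  0 < rho -> (forall i, valuation (v i)) -> (forall i, concave_on_orthant (v i)) ->
  is_allocation x -> power_maximal v rho x ->
  (forall i, regular r rho (v i (row i x))) ->
  (\forall t \near 0^'+, is_allocation (x + t *: d)) ->
  (forall i, ((v i (row i x + t *: row i d) - v i (row i x)) / t) @[t --> 0^'+] --> l i) ->
  \sum_i v i (row i x) `^ (rho - 1) * l i <= 0.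
Proof.
move=> rho0 vv vc ax mx reg ad dl.
apply: (@cvg_sum_le R 'I_n (fun i t => v i (row i x) `^ (rho - 1) *
  ((v i (row i x + t *: row i d) - v i (row i x)) / t))).
  by move=> i; apply: cvgMl_tmp; exact: dl.
near=> t.
have t0 : 0 < t by near: t; exact: nbhs_right_gt.
have at_ : is_allocation (x + t *: d) by near: t; exact: ad.
under eq_bigr do rewrite mulrA.
rewrite -mulr_suml ler_pdivrMr// mul0r.
have := maximal_linearized rho0 vv vc ax mx reg at_.
by under eq_bigr do rewrite linearD linearZ/=.
Unshelve. all: by end_near. Qed.

(* The price of a good is the marginal value it has for some agent consuming it.
   To compare it with the value that agent [i] attaches to a bundle [z], move
   [i] from its bundle towards [z], each excess demand being absorbed by the
   owner of the good. *)
Lemma maximal_supporting (R : realType) (n m : nat) (v : 'I_n -> 'rV[R]_m -> R)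
    (r rho : R) (x : 'M[R]_(n, m)) :
  0 < rho -> (forall i, valuation (v i)) ->
  (forall i, homogeneous r (v i)) -> (forall i, concave_on_orthant (v i)) ->
  (forall i, differentiable_on_orthant (v i)) ->
  is_allocation x -> power_maximal v rho x ->
  (forall i, regular r rho (v i (row i x))) ->
  exists q : 'I_m -> R, [/\ forall j, 0 <= q j,
    forall j, \sum_i x i j < 1 -> q j = 0 &
    forall i, supporting (v i) rho q (row i x)].
Proof.
move=> rho0 vv vr vc vd ax mx reg; have [x0 x1] := ax.
have xb i := row_bundle_nonneg i ax.
(* A consumer of good [j], chosen only when the good is fully allocated; a good with leftover supply
   has no owner and gets price zero. *)
pose own j := if \sum_i x i j == 1 then [pick k | 0 < x k j] else None.
have ownP j k : own j = Some k -> 0 < x k j.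
  rewrite /own; case: ifP => // _; case: pickP => // k' xk' [<-]//.
have own_none j : \sum_i x i j < 1 -> own j = None.
  by move=> h; rewrite /own lt_eqF.
have own_full j : \sum_i x i j = 1 -> exists k, own j = Some k.
  move=> h; rewrite /own h eqxx; case: pickP => [k _|none]; first by exists k.
  suff : \sum_i x i j = 0 by rewrite h => /eqP; rewrite oner_eq0.
  by apply: big1 => k _; apply/eqP; rewrite eq_le x0 leNgt none.
have row_neq0 k j : 0 < x k j -> row k x != 0.
  by move=> xkj; apply/eqP => /rowP/(_ j); rewrite !mxE => e; rewrite e ltxx in xkj.
pose a k := v k (row k x) `^ (rho - 1).
have a0 k : 0 <= a k by exact: powR_ge0.
pose L k (d : 'rV[R]_m) : R := 'd (v k) (row k x) d.
pose q j := if own j is Some k then a k * L k (unitv R j) else 0.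
have unit0 j : bundle_nonneg (unitv R j) by move=> k; rewrite mxE ler0n.
exists q; split=> [j|j /own_none|i z z0].
- rewrite /q; case: (own j) (ownP j) => // k /(_ _ erefl) xkj.
  rewrite mulr_ge0//; apply: diff_monotone => //.
  by apply: vd => //; exact: row_neq0 xkj.
- by rewrite /q => ->.
have [y yE] : exists y, y = z - row i x by eexists.
(* Agent [i] receives [y] and each owner gives up the same amount of its good; the two changes
   cancel when [i] is the owner. *)
pose d : 'M[R]_(n, m) :=
  \matrix_(k, j) (y 0 j * ((k == i)%:R - (own j == Some k)%:R)).
have feas : \forall t \near 0^'+, is_allocation (x + t *: d).
  (* A zero entry never decreases: its agent is not the owner, and for agent [i] it moves by
     [z 0 j]. *)
  have h1 : \forall t \near 0^'+, forall k : 'I_n, forall j : 'I_m, 0 <= x k j + t * d k j.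
    apply: filter_forall => k; apply: filter_forall => j.
    apply: nbhs_right_affine_ge0.
    have [xkj|xkj] := ltP 0 (x k j); [by left|right].
    have xkj0 : x k j = 0 by apply/eqP; rewrite eq_le xkj x0.
    split=> //; rewrite mxE.
    have -> : (own j == Some k) = false.
      by apply/eqP => /ownP; rewrite xkj0 ltxx.
    rewrite subr0; case: eqP => [ki|_]; last by rewrite mulr0.
    by rewrite mulr1 yE !mxE -ki xkj0 subr0.
  (* In a sold-out good the owner gives what [i] takes, so the column of [d] sums to zero; any other
     good has slack. *)
  have h2 : \forall t \near 0^'+, forall j : 'I_m,
      0 <= (1 - \sum_k x k j) + t * - \sum_k d k j.
    apply: filter_forall => j; apply: nbhs_right_affine_ge0.
    have := x1 j; rewrite le_eqVlt => /predU1P[xj|xj]; last by left; rewrite subr_gt0.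
    right; rewrite xj subrr; split=> //.
    have [k ownk] := own_full _ xj.
    under eq_bigr do rewrite mxE ownk mulrBr.
    rewrite sumrB -!mulr_sumr (bigD1 i)//= eqxx big1; last by move=> l /negbTE ->.
    rewrite (bigD1 k)//= eqxx big1 ?subrr ?oppr0// => l /negbTE lk.
    by rewrite eq_sym (inj_eq Some_inj) lk.
  near=> t.
  split=> [k j|j].
    have -> : (x + t *: d) k j = x k j + t * d k j by rewrite mxE [(t *: d) k j]mxE.
    by move: k j; near: t.
  have : forall j, 0 <= (1 - \sum_k x k j) + t * - \sum_k d k j by near: t.
  have -> : \sum_k (x + t *: d) k j = \sum_k x k j + t * \sum_k d k j.
    by rewrite mulr_sumr -big_split/=; apply: eq_bigr => k _; rewrite !mxE.
  by move=> /(_ j); lra.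
pose l k := if row k x == 0 then v k (row k d) else L k (row k d).
have rd0 k : row k x = 0 -> row k d = (k == i)%:R *: y.
  move=> xk; apply/rowP => j; rewrite !mxE.
  have -> : (own j == Some k) = false.
    by apply/eqP => /ownP/row_neq0; rewrite xk eqxx.
  by rewrite subr0 mulrC.
have dl k : ((v k (row k x + t *: row k d) - v k (row k x)) / t) @[t --> 0^'+] --> l k.
  rewrite /l; case: eqP => [xk|/eqP xk]; last first.
    by apply: dir_quotient_cvg; exact: vd.
  have r1 : r = 1 by have := reg k; rewrite xk => /(regular_zero (vv k)) [].
  rewrite xk; apply: zero_quotient_cvg.
  - by have [] := vv k.
  - by rewrite -r1.
  rewrite rd0//; case: eqP => [ki|_]; last by rewrite scale0r; exact: bundle_nonneg0.
  by rewrite scale1r yE -ki xk subr0.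
(* Concavity bounds the move of [i] towards [z], and linearity of the differential prices the owned
   goods given up at [q]. An agent with the zero bundle owns nothing. *)
have key k : (if k == i then a i * (v i z - v i (row i x)) else 0) -
    \sum_j (if own j == Some k then q j * y 0 j else 0) <= a k * l k.
  rewrite /l; have [xk|xk] := eqVneq (row k x) 0.
    rewrite big1 ?subr0; last first.
      move=> j _; case: eqP => // /ownP/row_neq0; by rewrite xk eqxx.
    rewrite rd0//; have v00 : v k 0 = 0 by have [] := vv k.
    case: eqP => [ki|_]; last by rewrite scale0r v00 mulr0.
    by rewrite scale1r yE -ki xk v00 !subr0.
  have dvk := vd k _ (xb k) xk.
  have -> : row k d = (k == i)%:R *: y -
      \sum_j (if own j == Some k then y 0 j else 0) *: unitv R j.
    apply/rowP => j; rewrite !mxE summxE (bigD1 j)//= big1 => [|j' /negbTE jj'].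
      rewrite !mxE !eqxx addr0; by case: ifP => _ /=; rewrite ?mulr1n ?mulr0n; ring.
    by rewrite !mxE [j == j']eq_sym jj' andbF mulr0.
  rewrite /L linearB linearZ ['d _ _ (\sum_(_ < _) _)]linear_sum/= (mulrBr (a k)) mulr_sumr lerB//.
    case: eqP => [ki|_]; last by rewrite scale0r mulr0.
    rewrite scale1r yE ki; apply: ler_wpM2l => //; apply: diff_concave => //.
    by rewrite -ki.
  rewrite le_eqVlt; apply/orP; left; apply/eqP; apply: eq_bigr => j _.
  rewrite linearZ/=; case: eqP => [oj|_]; last by rewrite scale0r mulr0.
  by rewrite /q oj -mulrA; congr (_ * _); exact: mulrC.
have := maximal_directional rho0 vv vc ax mx reg feas dl.
move/(le_trans (ler_sum _ (fun k _ => key k))).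
(* Each good has at most one owner, so the sum over agents counts [q j * y 0 j] once; a good without
   owner has [q j = 0]. *)
rewrite sumrB -big_mkcond big_pred1_eq exchange_big/= subr_le0 => /le_trans; apply.
rewrite le_eqVlt; apply/orP; left; apply/eqP.
rewrite /cost -sumrB; apply: eq_bigr => j _.
rewrite -mulrBr -big_mkcond/=.
have -> : z 0 j - row i x 0 j = y 0 j by rewrite yE !mxE.
case E : (own j) => [k|]; last by rewrite big_pred0// /q E mul0r.
by rewrite (big_pred1 k)// => k'; rewrite /= eq_sym.
Unshelve. all: by end_near. Qed.

(** * Prices of single goods and partial derivatives *)

Lemma cost_supported (R : realType) (m : nat) (q : 'I_m -> R) (y : 'rV[R]_m) j :
  (forall l, l != j -> y 0 l = 0) -> cost q y = q j * y 0 j.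
Proof.
move=> yj; rewrite /cost (bigD1 j)//= big1 ?addr0// => l lj.
by rewrite yj// mulr0.
Qed.

Lemma cost_unitv (R : realType) (m : nat) (q : 'I_m -> R) j :
  cost q (unitv R j) = q j.
Proof.
rewrite (@cost_supported _ _ _ _ j); first by rewrite mxE !eqxx mulr1.
by move=> l /negbTE lj; rewrite mxE lj andbF.
Qed.

(** This translates between market clearing and complementary slackness. *)
Lemma nonzero_cost_ces_price (R : realType) (m : nat) (r rho : R)
    (q : 'I_m -> R) j :
  0 < r -> 0 < rho -> 0 <= q j ->
  nonzero_cost (ces_price rho r q) j <-> 0 < q j.
Proof.
move=> r0 rho0 qj0; have irho0 : rho^-1 != 0 by rewrite invr_eq0 gt_eqF.
split=> [[y [_ [yj py]]]|qj].
  rewrite lt_neqAle qj0 andbT; apply: contraTneq py => qj.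
  by rewrite /ces_price -/(cost q y) (cost_supported q yj) -qj mul0r powR0// mulr0 ltxx.
exists (unitv R j); split; first by move=> k; rewrite mxE ler0n.
split; first by move=> l /negbTE lj; rewrite mxE lj andbF.
by rewrite /ces_price -/(cost q _) cost_unitv !mulr_gt0// powR_gt0.
Qed.

Lemma supporting_directional (R : realType) (m : nat) (v : 'rV[R]_m -> R)
    (rho : R) (q : 'I_m -> R) (x d : 'rV[R]_m) (l : R) :
  supporting v rho q x -> (\forall t \near 0^'+, bundle_nonneg (x + t *: d)) ->
  ((v (x + t *: d) - v x) / t) @[t --> 0^'+] --> l ->
  v x `^ (rho - 1) * l <= cost q d.
Proof.
move=> S xd dl.
have al : (v x `^ (rho - 1) * ((v (x + t *: d) - v x) / t)) @[t --> 0^'+]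
    --> v x `^ (rho - 1) * l by apply: cvgMl_tmp.
apply: (cvgr_to_le al); near=> t.
have t0 : 0 < t by near: t; exact: nbhs_right_gt.
have xt : bundle_nonneg (x + t *: d) by near: t.
rewrite mulrA ler_pdivrMr//; have := S _ xt; rewrite costD costZ; lra.
Unshelve. all: by end_near. Qed.

(** Since [partial] is a [lim], convergence must be known before it can be used. At the zero bundle
    regularity forces [r = 1], and the limit is the value of the unit bundle. *)
Lemma partial_cvg (R : realType) (m : nat) (v : 'rV[R]_m -> R) (r rho : R)
    (x : 'rV[R]_m) j :
  valuation v -> homogeneous r v -> differentiable_on_orthant v ->
  bundle_nonneg x -> regular r rho (v x) ->
  ((v (x + t *: unitv R j) - v x) / t) @[t --> 0^'+] --> partial v x j.
Proof.
move=> vv vr vd x0 reg.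
suff [l cl] : exists l : R, ((v (x + t *: unitv R j) - v x) / t) @[t --> 0^'+] --> l.
  rewrite /partial (_ : lim _ = l); [exact: cl|exact: cvg_lim].
have [x_eq0|x_neq0] := eqVneq x 0; last first.
  by exists ('d v x (unitv R j)); apply: dir_quotient_cvg; exact: vd.
exists (v (unitv R j)); rewrite x_eq0; apply: zero_quotient_cvg.
- by have [] := vv.
- by move: reg; rewrite x_eq0 => /(regular_zero vv)[<-].
- by move=> k; rewrite mxE ler0n.
Qed.

Lemma supporting_partial_le (R : realType) (m : nat) (v : 'rV[R]_m -> R)
    (r rho : R) (q : 'I_m -> R) (x : 'rV[R]_m) j :
  valuation v -> homogeneous r v -> differentiable_on_orthant v ->
  bundle_nonneg x -> regular r rho (v x) -> supporting v rho q x ->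
  v x `^ (rho - 1) * partial v x j <= q j.
Proof.
move=> vv vr vd x0 reg S; rewrite -[leRHS]cost_unitv.
apply: (supporting_directional S); last exact: partial_cvg reg.
near=> t; apply: bundle_nonnegD => //; apply: bundle_nonnegZ.
  by apply/ltW; near: t; exact: nbhs_right_gt.
by move=> k; rewrite mxE ler0n.
Unshelve. all: by end_near. Qed.

(** When [0 < x 0 j], the direction [- unitv R j] is feasible too, and linearity of the differential
    turns its bound into the reverse inequality. *)
Lemma supporting_partial_eq (R : realType) (m : nat) (v : 'rV[R]_m -> R)
    (r rho : R) (q : 'I_m -> R) (x : 'rV[R]_m) j :
  valuation v -> homogeneous r v -> differentiable_on_orthant v ->
  bundle_nonneg x -> regular r rho (v x) -> supporting v rho q x ->
  0 < x 0 j -> v x `^ (rho - 1) * partial v x j = q j.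
Proof.
move=> vv vr vd x0 reg S xj; apply/eqP; rewrite eq_le.
rewrite (supporting_partial_le _ vv vr vd x0 reg S)/=.
have x_neq0 : x != 0 by apply/eqP => /rowP/(_ j); rewrite mxE; lra.
have dv := vd _ x0 x_neq0.
have -> : partial v x j = 'd v x (unitv R j).
  by apply/esym/(cvg_unique _ (dir_quotient_cvg dv) (partial_cvg vv vr vd x0 reg)).
have cN : cost q (- unitv R j) = - q j.
  by rewrite -scaleN1r costZ cost_unitv mulN1r.
rewrite -lerN2 -mulrN -linearN -cN.
apply: (supporting_directional S); last exact: dir_quotient_cvg.
have : \forall t \near 0^'+, forall k, 0 <= x 0 k + t * (- unitv R j) 0 k.
  apply: filter_forall => k; apply: nbhs_right_affine_ge0.
  have [->|kj] := eqVneq k j; first by left.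
  rewrite !mxE (negbTE kj) andbF oppr0; have := x0 k.
  by rewrite le_eqVlt => /predU1P[<-|]; [right|left].
by apply: filterS => t h k; have := h k; rewrite !mxE.
Qed.

Theorem theorem1 (R : realType) (n m : nat) (v : 'I_n -> 'rV[R]_m -> R)
    (r rho : R) :
  0 < r -> r <= 1 -> 0 < rho -> rho <= 1 ->
  (forall i, valuation (v i)) ->
  (forall i, homogeneous r (v i)) ->
  (forall i, concave_on_orthant (v i)) ->
  (forall i, differentiable_on_orthant (v i)) ->
  forall x : 'M[R]_(n, m), is_allocation x ->
    (in_Psi v rho x <->
       exists q : 'I_m -> R, (forall j, 0 <= q j) /\
         walrasian_eq v x (ces_price rho r q)) /\
    (forall q : 'I_m -> R, (forall j, 0 <= q j) ->
       walrasian_eq v x (ces_price rho r q) -> optimal_lagrange v rho q).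
Proof.
move=> r0 r1 rho0 rho1 vv vr vc vd x ax; have [x0 x1] := ax.
have xb i := row_bundle_nonneg i ax.
have we q : (forall j, 0 <= q j) -> walrasian_eq v x (ces_price rho r q) ->
    [/\ forall i, regular r rho (v i (row i x)),
        forall i, supporting (v i) rho q (row i x) &
        forall j, \sum_i x i j < 1 -> q j = 0].
  move=> q0 [dx _ full]; split=> [i|i|j xj].
  - exact: (demand_regular r0 r1 rho0 rho1 (vv i) (vr i) q0 (dx i)).
  - exact: (demand_supporting r0 r1 rho0 rho1 (vv i) (vr i) (vc i) q0 (dx i)).
  (* A positive price on an unsold good would give it nonzero cost, and the equilibrium would then
     clear it. *)
  apply/eqP; rewrite eq_le q0 andbT leNgt; apply/negP => qj.
  have /full xj1 := (nonzero_cost_ces_price r0 rho0 (q0 j)).2 qj.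
  by rewrite xj1 ltxx in xj.
have wemax q : (forall j, 0 <= q j) -> walrasian_eq v x (ces_price rho r q) ->
    power_maximal v rho x.
  by move=> q0 /(we _ q0)[reg S slack]; exact: supporting_maximal reg S slack.
split; [split|].
- move=> /(in_PsiP v x rho0)[_ mx].
  have reg i := maximal_regular i r0 r1 rho0 rho1 vv vr vc ax mx.
  have [q [q0 slack S]] := maximal_supporting rho0 vv vr vc vd ax mx reg.
  exists q; split=> //; split=> // [i|j].
    apply: supporting_demand => //.
    by have [v0 _ _ _] := vv i; exact: v0.
  move=> /(nonzero_cost_ces_price r0 rho0 (q0 j)).1 qj.
  apply/eqP; rewrite eq_le x1 leNgt; apply/negP => /slack qj0.
  by rewrite qj0 ltxx in qj.
- move=> [q [q0 wq]]; apply/(in_PsiP v x rho0); split=> //.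
  exact: wemax wq.
move=> q q0 wq; have [reg S slack] := we q q0 wq.
(* The equilibrium allocation itself is the optimal point required of the multipliers. *)
split=> //; exists x; split; last split=> // i j.
  split=> //; split=> // x' x'0 x'1.
  rewrite /P_objective ler_pM2l ?invr_gt0//.
  exact: (wemax q q0 wq).
split; first exact: (supporting_partial_le _ (vv i) (vr i) (vd i) (xb i) (reg i) (S i)).
move=> xij; apply: (supporting_partial_eq (vv i) (vr i) (vd i) (xb i) (reg i) (S i)).
by rewrite mxE.
Qed.
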